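(* (Cut elimination and subformula property.) Let $\mathcal{L}$ be a first-order language over a countable set $\mathsf{Var}$ of variables. The calculus $\mathrm{D.FO}$ enjoys cut elimination and the subformula property: every sequent $X\vdash_F Y$ derivable in $\mathrm{D.FO}$ is derivable in $\mathrm{D.FO}$ without using the rule Cut, and in every Cut-free derivation of $X\vdash_F Y$ in $\mathrm{D.FO}$ every formula occurring in the derivation is a subformula of some formula occurring in $X$ or in $Y$.
   Context: **First-order language.** $\mathsf{Var}=\{v_1,v_2,\dots\}$ is countable; $\mathcal{P}_\omega(\mathsf{Var})$ is the set of its finite subsets. $\mathcal{L}$ has relation symbols, function symbols (each of finite arity) and constants. Terms are as usual; formulas are $A::=R(\overline t)\mid t_1=t_2\mid\top\mid\bot\mid A\wedge A\mid A\vee A\mid A\to A\mid\forall yA\mid\exists yA$. $\mathsf{FV}$ denotes the set of free variables. For $F\in\mathcal{P}_\omega(\mathsf{Var})$, $t_F$ denotes a family $(t_v)_{v\in F}$ of terms, and $\mathsf{FV}(t_F)=\bigcup_{v\in F}\mathsf{FV}(t_v)$. If $y\notin F$, then $(s_y,t_F)$ is the family on $F\cup\{y\}$ sending $y$ to $s$ and agreeing with $t_F$ on $F$ (so in $(z_y,t_F)$ the variable $y$ is sent to the variable $z$). Sequences of distinct variables are identified with their sets of elements; $R(t_{\overline x})$ is an atomic formula whose argument list is the sequence of terms $t_{\overline x}$. $A(t_{\overline x}/\overline x)$ and $s(t_{\overline x}/\overline x)$ denote simultaneous capture-avoiding substitution, formulas of $\mathcal{L}$ being taken up to renaming of bound variables.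 If $\mathsf{FV}(s_T)=\overline x$, then $s(t_{\overline x}/\overline x)_T$ is the family $(s_v(t_{\overline x}/\overline x))_{v\in T}$. **Multi-type formulas.** For each type $F\in\mathcal{P}_\omega(\mathsf{Var})$ the set $\mathcal{L}_F$ of formulas of type $F$ is given by simultaneous induction: $R(t_{\overline x})$ with $\mathsf{FV}(t_{\overline x})=F$; $s=t$ with $\mathsf{FV}(s)\cup\mathsf{FV}(t)=F$; $\top^F$, $\bot^F$; $A\wedge B$, $A\vee B$, $A\to B$ with $A,B\in\mathcal{L}_F$; $[y]A$ and $\langle y\rangle A$ with $y\notin F$, $A\in\mathcal{L}_{F\cup\{y\}}$; $(x)A$ with $x\in F$, $A\in\mathcal{L}_{F\setminus\{x\}}$; $(t_{F'})A$ with $A\in\mathcal{L}_{F'}$ and $\mathsf{FV}(t_{F'})=F$. $\mathcal{L}_{\mathrm{MT}}=\bigcup_F\mathcal{L}_F$. ''Formula'' in the claim means formula of $\mathcal{L}_{\mathrm{MT}}$ (the structural atoms $\hat R(t_{\overline x})$ and $s\,\hat=\,t$ introduced below are structures, not formulas). The translation $(\cdot)^\tau:\mathcal{L}_{\mathrm{MT}}\to\mathcal{L}$ is the identity on atomic formulas, sends $\top^F,\bot^F$ to $\top,\bot$, commutes with $\wedge,\vee,\to$, and $([y]A)^\tau=\forall yA^\tau$, $(\langle y\rangle A)^\tau=\exists yA^\tau$, $((x)A)^\tau=A^\tau$, $((t_{F'})A)^\tau=A^\tau(t_{F'}/F')$. **Structures and sequents.** Precedent structures of each type: formulas, $\hat\top_F$,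 $\hat R(t_{\overline x})$ (type $\mathsf{FV}(t_{\overline x})$), $s\,\hat=\,t$ (type $\mathsf{FV}(s)\cup\mathsf{FV}(t)$), $X\hat\wedge X'$, $Y\hat\succ X$, $X\hat\prec Y$, $\langle\hat x\rangle X$, $(\tilde x)X$, $(\tilde t_{F})X$, $\langle\hat t_F\rangle X$, where $X,X'$ are precedent and $Y$ succedent structures. Succedent structures: formulas, $\check\bot_F$, $Y\check\vee Y'$, $X\check\to Y$, $Y\check\leftarrow X$, $[\check x]Y$, $(\tilde x)Y$, $(\tilde t_F)Y$, $[\check t_F]Y$, where $X$ is precedent, $Y,Y'$ are succedent. Binary connectives combine structures of one and the same type. $\langle\hat x\rangle,[\check x]$ take type $F\cup\{x\}$ to $F\setminus\{x\}$; $(\tilde x)$ takes type $F\setminus\{x\}$ to $F\cup\{x\}$; $(\tilde t_F)$ takes type $F$ to $\mathsf{FV}(t_F)$; $\langle\hat t_F\rangle,[\check t_F]$ take type $\mathsf{FV}(t_F)$ to $F$. A sequent $X\vdash_F Y$ has $X$ precedent and $Y$ succedent, both of type $F$. **Rules of $\mathrm{D.FO}$** (premises / conclusion; ''//'' means the rule may be used in both directions; all sequents well-formed and well-typed). 1. Identity: $\hat R(t_{\overline x})\vdash R(t_{\overline x})$; $s\,\hat=\,t\vdash s=t$. Cut: $X\vdash_F A$ and $A\vdash_F Y$ / $X\vdash_F Y$. 2. $X\hat\wedge Y\vdash Z$ // $Y\vdash X\check\to Z$; $X\hat\wedge Y\vdash Z$ // $X\vdash Z\check\leftarrow Y$; $Z\vdash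 X\check\vee Y$ // $X\hat\succ Z\vdash Y$; $Z\vdash X\check\vee Y$ // $Z\hat\prec Y\vdash X$. 3. $X\vdash_{F\cup\{x\}}(\tilde x)Y$ // $\langle\hat x\rangle X\vdash_{F\setminus\{x\}}Y$; $(\tilde x)Y\vdash_{F\cup\{x\}}X$ // $Y\vdash_{F\setminus\{x\}}[\check x]X$. 4. With $F'=\mathsf{FV}(t_F)$: $Y\vdash_{F'}(\tilde t_F)X$ // $\langle\hat t_F\rangle Y\vdash_F X$; $(\tilde t_F)X\vdash_{F'}Y$ // $X\vdash_F[\check t_F]Y$. 5. $(\tilde x)\langle\hat x\rangle X\vdash Y$ / $X\vdash Y$; $(\tilde t_{F'})\langle\hat t_{F'}\rangle X\vdash Y$ / $X\vdash Y$. 6. $\hat\top_{F\cup\{x\}}\vdash X$ // $(\tilde x)\hat\top_{F\setminus\{x\}}\vdash X$; $X\vdash\check\bot_{F\cup\{x\}}$ // $X\vdash(\tilde x)\check\bot_{F\setminus\{x\}}$. 7. With $\mathsf{FV}(t_{F'})=F$: $\hat\top_F\vdash X$ // $(\tilde t_{F'})\hat\top_{F'}\vdash X$; $X\vdash\check\bot_F$ // $X\vdash(\tilde t_{F'})\check\bot_{F'}$. 8. $(\tilde s_{T_1})\cdots(\tilde s_{T_m})\hat R(s_{\overline x})\vdash X$ / $(\tilde t_{F_1})\cdots(\tilde t_{F_k})\hat R(t_{\overline x})\vdash X$, provided $((t_{F_1})\cdots(t_{F_k})R(t_{\overline x}))^\tau=((s_{T_1})\cdots(s_{T_m})R(s_{\overline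 x}))^\tau$; and $(\tilde s_{T_1})\cdots(\tilde s_{T_m})(r_3\,\hat=\,r_4)\vdash X$ / $(\tilde t_{F_1})\cdots(\tilde t_{F_k})(r_1\,\hat=\,r_2)\vdash X$, provided $((t_{F_1})\cdots(t_{F_k})\,r_1=r_2)^\tau=((s_{T_1})\cdots(s_{T_m})\,r_3=r_4)^\tau$. 9. $X\vdash Y$ // $\hat\top\hat\wedge X\vdash Y$; $Y\vdash X$ // $Y\vdash X\check\vee\check\bot$; exchange: $Y\hat\wedge X\vdash Z$ / $X\hat\wedge Y\vdash Z$ and $Z\vdash X\check\vee Y$ / $Z\vdash Y\check\vee X$; weakening: $Y\vdash Z$ / $X\hat\wedge Y\vdash Z$ and $Z\vdash Y$ / $Z\vdash Y\check\vee X$; contraction: $X\hat\wedge X\vdash Y$ / $X\vdash Y$ and $Y\vdash X\check\vee X$ / $Y\vdash X$; associativity: $X\hat\wedge(Y\hat\wedge Z)\vdash W$ // $(X\hat\wedge Y)\hat\wedge Z\vdash W$ and $W\vdash(Z\check\vee Y)\check\vee X$ // $W\vdash Z\check\vee(Y\check\vee X)$. 10. Equality: $(t\,\hat=\,t)\hat\wedge X\vdash Y$ / $X\vdash Y$; and $(\tilde x_1)\cdots(\tilde x_n)(t\,\hat=\,s)\vdash(\tilde y_1)\cdots(\tilde y_m)(\widetilde{t_y,r_F})X$ / $(\tilde x_1)\cdots(\tilde x_n)(t\,\hat=\,s)\vdash(\tilde z_1)\cdots(\tilde z_k)(\widetilde{s_y,r_F})X$, where $\{x_i\}=\mathsf{FV}(r_F)\setminus\mathsf{FV}(t,s)$,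 $\{y_i\}=\mathsf{FV}(s)\setminus\mathsf{FV}(t,r_F)$, $\{z_i\}=\mathsf{FV}(t)\setminus\mathsf{FV}(s,r_F)$. 11. $\hat R(s_{\overline x})\vdash X$ / $R(s_{\overline x})\vdash X$; $s\,\hat=\,t\vdash X$ / $s=t\vdash X$. 12. $\bot\vdash\check\bot$; $X\vdash\check\bot$ / $X\vdash\bot$; $\hat\top\vdash X$ / $\top\vdash X$; $\hat\top\vdash\top$; $A\hat\wedge B\vdash X$ / $A\wedge B\vdash X$; $X\vdash A$ and $Y\vdash B$ / $X\hat\wedge Y\vdash A\wedge B$; $A\vdash X$ and $B\vdash Y$ / $A\vee B\vdash X\check\vee Y$; $X\vdash A\check\vee B$ / $X\vdash A\vee B$; $X\vdash A$ and $B\vdash Y$ / $A\to B\vdash X\check\to Y$; $X\vdash A\check\to B$ / $X\vdash A\to B$. 13. Grishin: $X\hat\succ(Y\hat\wedge Z)\vdash W$ / $(X\hat\succ Y)\hat\wedge Z\vdash W$; $W\vdash X\check\to(Y\check\vee Z)$ / $W\vdash(X\check\to Y)\check\vee Z$. 14. $\langle\hat x\rangle A\vdash X$ / $\langle x\rangle A\vdash X$; $X\vdash A$ / $\langle\hat x\rangle X\vdash\langle x\rangle A$; $A\vdash X$ / $[x]A\vdash[\check x]X$; $X\vdash[\check x]A$ / $X\vdash[x]A$; $(\tilde x)A\vdash X$ / $(x)A\vdash X$; $X\vdash(\tilde x)A$ / $X\vdash(x)A$; $(\tilde t_{F'})A\vdash X$ / $(t_{F'})A\vdash X$; $X\vdash(\tilde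 t_{F'})A$ / $X\vdash(t_{F'})A$. 15. $X\vdash_{F\setminus\{x\}}Y$ // $(\tilde x)X\vdash_{F\cup\{x\}}(\tilde x)Y$; $X\vdash_{F'}Y$ / $(\tilde t_{F'})X\vdash_F(\tilde t_{F'})Y$. 16. For $\star$ either $\tilde x$ or $\tilde t_F$: $(\star)X\,\hat\circ\,(\star)Y\vdash Z$ // $(\star)(X\,\hat\circ\,Y)\vdash Z$ for $\hat\circ\in\{\hat\wedge,\hat\succ,\hat\prec\}$; $Z\vdash(\star)X\,\check\circ\,(\star)Y$ // $Z\vdash(\star)(X\,\check\circ\,Y)$ for $\check\circ\in\{\check\vee,\check\to,\check\leftarrow\}$. 17. With $x\neq y$: $(\tilde x)\langle\hat y\rangle X\vdash Y$ // $\langle\hat y\rangle(\tilde x)X\vdash Y$; $Y\vdash(\tilde x)[\check y]X$ // $Y\vdash[\check y](\tilde x)X$; $(\tilde x)(\tilde y)X\vdash Y$ // $(\tilde y)(\tilde x)X\vdash Y$; $Y\vdash(\tilde x)(\tilde y)X$ // $Y\vdash(\tilde y)(\tilde x)X$. With $z\notin\mathsf{FV}(t_{F'})\cup F'$: $(\tilde t_{F'})\langle\hat y\rangle X\vdash Y$ // $\langle\hat z\rangle(\widetilde{z_y,t_{F'}})X\vdash Y$; $Y\vdash(\tilde t_{F'})[\check y]X$ // $Y\vdash[\check z](\widetilde{z_y,t_{F'}})X$. With $\overline x=F=\mathsf{FV}(s_{F'})$: $(\tilde t_F)(\tilde s_{F'})X\vdash Y$ // $(\widetilde{s(t_{\overline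 x}/\overline x)}_{F'})X\vdash Y$; $Y\vdash(\tilde t_F)(\tilde s_{F'})X$ // $Y\vdash(\widetilde{s(t_{\overline x}/\overline x)}_{F'})X$. With $\{z_1,\dots,z_k\}=\mathsf{FV}(s)\setminus\mathsf{FV}(t_F)$: $(\widetilde{s_y,t_F})(\tilde y)X\vdash Y$ // $(\tilde z_1)\cdots(\tilde z_k)(\tilde t_F)X\vdash Y$; $Y\vdash(\widetilde{s_y,t_F})(\tilde y)X$ // $Y\vdash(\tilde z_1)\cdots(\tilde z_k)(\tilde t_F)X$. *)

(* Defs.v *)
From HB Require Import structures.
From mathcomp Require Import all_boot.
From mathcomp Require Import finmap.

Set Implicit Arguments.
Unset Strict Implicit.
Unset Printing Implicit Defensive.

Local Open Scope fset_scope.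
Local Open Scope fmap_scope.

(* The variable v_(n+1) is the number n. *)
Notation Var := nat.

Record language := Language {
  relsym : Type;
  rel_arity : relsym -> nat;
  funsym : Type;
  fun_arity : funsym -> nat;
  constsym : Type }.

Inductive term (L : language) : Type :=
| TVar of Var
| TConst of constsym L
| TFun (f : funsym L) of {ffun 'I_(fun_arity f) -> term L}.

Arguments TVar {L} _.
Arguments TConst {L} _.
Arguments TFun {L f} _.

Notation args L n := {ffun 'I_n -> term L}.
Notation family L := {fmap Var -> term L}.

Fixpoint tfv (L : language) (t : term L) : {fset Var} :=
  match t with
  | TVar v => [fset v]
  | TConst _ => fset0
  | TFun f ts => \big[fsetU/fset0]_(i < fun_arity f) tfv (ts i)
  end.

Definition args_fv (L : language) n (ts : args L n) : {fset Var} :=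
  \big[fsetU/fset0]_(i < n) tfv (ts i).

Definition family_fv (L : language) (t : family L) : {fset Var} :=
  \big[fsetU/fset0]_(v : domf t) tfv (t v).

(* Variables outside the domain of the family are left unchanged. *)
Fixpoint tsubst (L : language) (t : family L) (s : term L) : term L :=
  match s with
  | TVar v => if t.[? v] is Some u then u else TVar v
  | TConst c => TConst c
  | TFun f ss => TFun [ffun i => tsubst t (ss i)]
  end.

Definition args_subst (L : language) (t : family L) n (ss : args L n) :
  args L n := [ffun i => tsubst t (ss i)].

Definition family_subst (L : language) (t s : family L) : family L :=
  [fmap v : domf s => tsubst t (s v)].

Inductive fo_form (L : language) : Type :=
| FRel (r : relsym L) of args L (rel_arity r)
| FEq of term L & term L
| FTop
| FBot
| FAnd of fo_form L & fo_form L
| FOr of fo_form L & fo_form L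
| FImp of fo_form L & fo_form L
| FAll of Var & fo_form L
| FEx of Var & fo_form L.

Arguments FRel {L r} _.
Arguments FTop {L}.
Arguments FBot {L}.

Fixpoint fo_fv (L : language) (A : fo_form L) : {fset Var} :=
  match A with
  | FRel _ ts => args_fv ts
  | FEq s t => tfv s `|` tfv t
  | FTop | FBot => fset0
  | FAnd A B | FOr A B | FImp A B => fo_fv A `|` fo_fv B
  | FAll y A | FEx y A => fo_fv A `\ y
  end.

Definition fresh (F : {fset Var}) : Var := (\max_(v <- enum_fset F) v).+1.

(* Simultaneous substitution; every bound variable is renamed to one that is
   fresh for the body and for the substituted terms, hence no capture. *)
Fixpoint fo_subst (L : language) (t : family L) (A : fo_form L) : fo_form L :=
  match A with
  | FRel r ts => FRel (args_subst t ts)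
  | FEq s u => FEq (tsubst t s) (tsubst t u)
  | FTop => FTop
  | FBot => FBot
  | FAnd A B => FAnd (fo_subst t A) (fo_subst t B)
  | FOr A B => FOr (fo_subst t A) (fo_subst t B)
  | FImp A B => FImp (fo_subst t A) (fo_subst t B)
  | FAll y A =>
      let z := fresh (fo_fv A `|` family_fv t) in
      FAll z (fo_subst t.[y <- TVar z] A)
  | FEx y A =>
      let z := fresh (fo_fv A `|` family_fv t) in
      FEx z (fo_subst t.[y <- TVar z] A)
  end.

Inductive alpha_eq (L : language) : fo_form L -> fo_form L -> Prop :=
| alpha_refl A : alpha_eq A A
| alpha_sym A B : alpha_eq A B -> alpha_eq B A
| alpha_trans A B C : alpha_eq A B -> alpha_eq B C -> alpha_eq A C
| alpha_and A A' B B' :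
    alpha_eq A A' -> alpha_eq B B' -> alpha_eq (FAnd A B) (FAnd A' B')
| alpha_or A A' B B' :
    alpha_eq A A' -> alpha_eq B B' -> alpha_eq (FOr A B) (FOr A' B')
| alpha_imp A A' B B' :
    alpha_eq A A' -> alpha_eq B B' -> alpha_eq (FImp A B) (FImp A' B')
| alpha_all y A A' : alpha_eq A A' -> alpha_eq (FAll y A) (FAll y A')
| alpha_ex y A A' : alpha_eq A A' -> alpha_eq (FEx y A) (FEx y A')
| alpha_all_rename y z A : z \notin fo_fv A ->
    alpha_eq (FAll y A) (FAll z (fo_subst [fmap].[y <- TVar z] A))
| alpha_ex_rename y z A : z \notin fo_fv A ->
    alpha_eq (FEx y A) (FEx z (fo_subst [fmap].[y <- TVar z] A)).

(* Raw syntax; the formulas of type F are singled out by [mtype _ F].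
     MAll y A  is  [y]A        MEx y A   is  <y>A
     MInc x A  is  (x)A        MSub t A  is  (t_F)A, with F = domf t *)
Inductive mform (L : language) : Type :=
| MRel (r : relsym L) of args L (rel_arity r)
| MEq of term L & term L
| MTop of {fset Var}
| MBot of {fset Var}
| MAnd of mform L & mform L
| MOr of mform L & mform L
| MImp of mform L & mform L
| MAll of Var & mform L
| MEx of Var & mform L
| MInc of Var & mform L
| MSub of family L & mform L.

Arguments MRel {L r} _.
Arguments MTop {L} _.
Arguments MBot {L} _.

Inductive mtype (L : language) : mform L -> {fset Var} -> Prop :=
| mtype_rel r (ts : args L (rel_arity r)) : mtype (MRel ts) (args_fv ts)
| mtype_eq s t : mtype (MEq s t) (tfv s `|` tfv t)
| mtype_top F : mtype (MTop F) F
| mtype_bot F : mtype (MBot F) F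
| mtype_and F A B : mtype A F -> mtype B F -> mtype (MAnd A B) F
| mtype_or F A B : mtype A F -> mtype B F -> mtype (MOr A B) F
| mtype_imp F A B : mtype A F -> mtype B F -> mtype (MImp A B) F
| mtype_all F y A : y \notin F -> mtype A (y |` F) -> mtype (MAll y A) F
| mtype_ex F y A : y \notin F -> mtype A (y |` F) -> mtype (MEx y A) F
| mtype_inc F x A : x \in F -> mtype A (F `\ x) -> mtype (MInc x A) F
| mtype_sub t A : mtype A (domf t) -> mtype (MSub t A) (family_fv t).

Fixpoint tau (L : language) (A : mform L) : fo_form L :=
  match A with
  | MRel _ ts => FRel ts
  | MEq s t => FEq s t
  | MTop _ => FTop
  | MBot _ => FBot
  | MAnd A B => FAnd (tau A) (tau B)
  | MOr A B => FOr (tau A) (tau B)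
  | MImp A B => FImp (tau A) (tau B)
  | MAll y A => FAll y (tau A)
  | MEx y A => FEx y (tau A)
  | MInc _ A => tau A
  | MSub t A => fo_subst t (tau A)
  end.

Inductive subformula (L : language) (A : mform L) : mform L -> Prop :=
| sub_refl : subformula A A
| sub_andl B C : subformula A B -> subformula A (MAnd B C)
| sub_andr B C : subformula A C -> subformula A (MAnd B C)
| sub_orl B C : subformula A B -> subformula A (MOr B C)
| sub_orr B C : subformula A C -> subformula A (MOr B C)
| sub_impl B C : subformula A B -> subformula A (MImp B C)
| sub_impr B C : subformula A C -> subformula A (MImp B C)
| sub_all y B : subformula A B -> subformula A (MAll y B)
| sub_ex y B : subformula A B -> subformula A (MEx y B)
| sub_inc x B : subformula A B -> subformula A (MInc x B)
| sub_sub t B : subformula A B -> subformula A (MSub t B).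

(* Precedent structures (constructors P...), with ^ a hat and ~ a tilde:
     PSucc Y X    Y ^succ X        PPrec X Y    X ^prec Y
     PEx x X      <^x>X            PExSub t X   <^t_F>X
     PInc x X     (~x)X            PSub t X     (~t_F)X
   Succedent structures (constructors S...), with v a check:
     SImp X Y     X v-> Y          SLmi Y X     Y v<- X
     SAll x Y     [vx]Y            SAllSub t Y  [vt_F]Y
     SInc x Y     (~x)Y            SSub t Y     (~t_F)Y *)
Inductive pstr (L : language) : Type :=
| PForm of mform L
| PTop of {fset Var}
| PRel (r : relsym L) of args L (rel_arity r)
| PEq of term L & term L
| PAnd of pstr L & pstr L
| PSucc of sstr L & pstr L
| PPrec of pstr L & sstr L
| PEx of Var & pstr L
| PInc of Var & pstr L
| PSub of family L & pstr L
| PExSub of family L & pstr L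
with sstr (L : language) : Type :=
| SForm of mform L
| SBot of {fset Var}
| SOr of sstr L & sstr L
| SImp of pstr L & sstr L
| SLmi of sstr L & pstr L
| SAll of Var & sstr L
| SInc of Var & sstr L
| SSub of family L & sstr L
| SAllSub of family L & sstr L.

Arguments PTop {L} _.
Arguments PRel {L r} _.
Arguments SBot {L} _.

Inductive ptype (L : language) : pstr L -> {fset Var} -> Prop :=
| ptype_form F A : mtype A F -> ptype (PForm A) F
| ptype_top F : ptype (PTop F) F
| ptype_rel r (ts : args L (rel_arity r)) : ptype (PRel ts) (args_fv ts)
| ptype_eq s t : ptype (PEq s t) (tfv s `|` tfv t)
| ptype_and F X X' : ptype X F -> ptype X' F -> ptype (PAnd X X') F
| ptype_succ F Y X : stype Y F -> ptype X F -> ptype (PSucc Y X) F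
| ptype_prec F X Y : ptype X F -> stype Y F -> ptype (PPrec X Y) F
| ptype_ex F x X : ptype X (x |` F) -> ptype (PEx x X) (F `\ x)
| ptype_inc F x X : ptype X (F `\ x) -> ptype (PInc x X) (x |` F)
| ptype_sub t X : ptype X (domf t) -> ptype (PSub t X) (family_fv t)
| ptype_exsub t X : ptype X (family_fv t) -> ptype (PExSub t X) (domf t)
with stype (L : language) : sstr L -> {fset Var} -> Prop :=
| stype_form F A : mtype A F -> stype (SForm A) F
| stype_bot F : stype (SBot F) F
| stype_or F Y Y' : stype Y F -> stype Y' F -> stype (SOr Y Y') F
| stype_imp F X Y : ptype X F -> stype Y F -> stype (SImp X Y) F
| stype_lmi F Y X : stype Y F -> ptype X F -> stype (SLmi Y X) F
| stype_all F x Y : stype Y (x |` F) -> stype (SAll x Y) (F `\ x)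
| stype_inc F x Y : stype Y (F `\ x) -> stype (SInc x Y) (x |` F)
| stype_sub t Y : stype Y (domf t) -> stype (SSub t Y) (family_fv t)
| stype_allsub t Y : stype Y (family_fv t) -> stype (SAllSub t Y) (domf t).

Record sequent (L : language) : Type := Sequent {
  seq_pre : pstr L;
  seq_type : {fset Var};
  seq_suc : sstr L }.

Notation "X |-[ F ] Y" := (Sequent X F Y)
  (at level 70, F at level 200, no associativity, format "X  |-[ F ]  Y").

Definition well_typed (L : language) (S : sequent L) : Prop :=
  ptype (seq_pre S) (seq_type S) /\ stype (seq_suc S) (seq_type S).

(* The formulas occurring in a structure are those standing at its leaves. *)
Fixpoint in_pstr (L : language) (A : mform L) (X : pstr L) : Prop :=
  match X with
  | PForm B => A = B
  | PTop _ | PRel _ _ | PEq _ _ => False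
  | PAnd X X' => in_pstr A X \/ in_pstr A X'
  | PSucc Y X | PPrec X Y => in_pstr A X \/ in_sstr A Y
  | PEx _ X | PInc _ X | PSub _ X | PExSub _ X => in_pstr A X
  end
with in_sstr (L : language) (A : mform L) (Y : sstr L) : Prop :=
  match Y with
  | SForm B => A = B
  | SBot _ => False
  | SOr Y Y' => in_sstr A Y \/ in_sstr A Y'
  | SImp X Y | SLmi Y X => in_pstr A X \/ in_sstr A Y
  | SAll _ Y | SInc _ Y | SSub _ Y | SAllSub _ Y => in_sstr A Y
  end.

Definition in_sequent (L : language) (A : mform L) (S : sequent L) : Prop :=
  in_pstr A (seq_pre S) \/ in_sstr A (seq_suc S).

Definition lists (xs : seq Var) (F : {fset Var}) : Prop :=
  uniq xs /\ xs =i F.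

Definition MSubs (L : language) (ts : seq (family L)) (A : mform L) : mform L :=
  foldr (@MSub L) A ts.
Definition PSubs (L : language) (ts : seq (family L)) (X : pstr L) : pstr L :=
  foldr (@PSub L) X ts.
Definition PIncs (L : language) (xs : seq Var) (X : pstr L) : pstr L :=
  foldr (@PInc L) X xs.
Definition SIncs (L : language) (xs : seq Var) (Y : sstr L) : sstr L :=
  foldr (@SInc L) Y xs.

(* The tilde operators (~x) and (~t_F), for the rules stated for both. *)
Inductive tilde (L : language) : Type :=
| TildeVar of Var
| TildeFam of family L.

Definition ptilde (L : language) (o : tilde L) (X : pstr L) : pstr L :=
  match o with TildeVar x => PInc x X | TildeFam t => PSub t X end.
Definition stilde (L : language) (o : tilde L) (Y : sstr L) : sstr L :=
  match o with TildeVar x => SInc x Y | TildeFam t => SSub t Y end.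

(* In the rules below the typing side conditions are left implicit: only
   well-typed sequents are allowed in derivations, see [derivation]. *)

Inductive axiom (L : language) : sequent L -> Prop :=
| ax_rel F r (ts : args L (rel_arity r)) :
    axiom (PRel ts |-[F] SForm (MRel ts))
| ax_eq F s t : axiom (PEq s t |-[F] SForm (MEq s t))
| ax_bot F : axiom (PForm (MBot F) |-[F] SBot F)
| ax_top F : axiom (PTop F |-[F] SForm (MTop F)).

(* The rules that may be used in both directions; [r_down] and [r_up] below
   make each of them two rules. *)
Inductive dline (L : language) : sequent L -> sequent L -> Prop :=
| d_and_imp F X Y Z :
    dline (PAnd X Y |-[F] Z) (Y |-[F] SImp X Z)
| d_and_lmi F X Y Z :
    dline (PAnd X Y |-[F] Z) (X |-[F] SLmi Z Y)
| d_or_succ F X Y Z :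
    dline (Z |-[F] SOr X Y) (PSucc X Z |-[F] Y)
| d_or_prec F X Y Z :
    dline (Z |-[F] SOr X Y) (PPrec Z Y |-[F] X)
| d_ex_inc F x X Y :
    dline (X |-[x |` F] SInc x Y) (PEx x X |-[F `\ x] Y)
| d_inc_all F x X Y :
    dline (PInc x Y |-[x |` F] X) (Y |-[F `\ x] SAll x X)
| d_ex_sub t X Y :
    dline (Y |-[family_fv t] SSub t X) (PExSub t Y |-[domf t] X)
| d_sub_all t X Y :
    dline (PSub t X |-[family_fv t] Y) (X |-[domf t] SAllSub t Y)
| d_top_inc F x X :
    dline (PTop (x |` F) |-[x |` F] X) (PInc x (PTop (F `\ x)) |-[x |` F] X)
| d_bot_inc F x X :
    dline (X |-[x |` F] SBot (x |` F)) (X |-[x |` F] SInc x (SBot (F `\ x)))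
| d_top_sub t X :
    dline (PTop (family_fv t) |-[family_fv t] X)
          (PSub t (PTop (domf t)) |-[family_fv t] X)
| d_bot_sub t X :
    dline (X |-[family_fv t] SBot (family_fv t))
          (X |-[family_fv t] SSub t (SBot (domf t)))
| d_top F X Y :
    dline (X |-[F] Y) (PAnd (PTop F) X |-[F] Y)
| d_bot F X Y :
    dline (Y |-[F] X) (Y |-[F] SOr X (SBot F))
| d_and_assoc F X Y Z W :
    dline (PAnd X (PAnd Y Z) |-[F] W) (PAnd (PAnd X Y) Z |-[F] W)
| d_or_assoc F X Y Z W :
    dline (W |-[F] SOr (SOr Z Y) X) (W |-[F] SOr Z (SOr Y X))
| d_inc_mono F x X Y :
    dline (X |-[F `\ x] Y) (PInc x X |-[x |` F] SInc x Y)
| d_tilde_and F o X Y Z :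
    dline (PAnd (ptilde o X) (ptilde o Y) |-[F] Z)
          (ptilde o (PAnd X Y) |-[F] Z)
| d_tilde_succ F o X Y Z :
    dline (PSucc (stilde o X) (ptilde o Y) |-[F] Z)
          (ptilde o (PSucc X Y) |-[F] Z)
| d_tilde_prec F o X Y Z :
    dline (PPrec (ptilde o X) (stilde o Y) |-[F] Z)
          (ptilde o (PPrec X Y) |-[F] Z)
| d_tilde_or F o X Y Z :
    dline (Z |-[F] SOr (stilde o X) (stilde o Y))
          (Z |-[F] stilde o (SOr X Y))
| d_tilde_imp F o X Y Z :
    dline (Z |-[F] SImp (ptilde o X) (stilde o Y))
          (Z |-[F] stilde o (SImp X Y))
| d_tilde_lmi F o X Y Z :
    dline (Z |-[F] SLmi (stilde o X) (ptilde o Y))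
          (Z |-[F] stilde o (SLmi X Y))
| d_inc_ex F x y X Y : x != y ->
    dline (PInc x (PEx y X) |-[F] Y) (PEx y (PInc x X) |-[F] Y)
| d_inc_all_comm F x y X Y : x != y ->
    dline (Y |-[F] SInc x (SAll y X)) (Y |-[F] SAll y (SInc x X))
| d_inc_incl F x y X Y : x != y ->
    dline (PInc x (PInc y X) |-[F] Y) (PInc y (PInc x X) |-[F] Y)
| d_inc_incr F x y X Y : x != y ->
    dline (Y |-[F] SInc x (SInc y X)) (Y |-[F] SInc y (SInc x X))
| d_sub_ex F t y z X Y :
    y \notin domf t -> z \notin family_fv t `|` domf t ->
    dline (PSub t (PEx y X) |-[F] Y)
          (PEx z (PSub t.[y <- TVar z] X) |-[F] Y)
| d_sub_all_comm F t y z X Y :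
    y \notin domf t -> z \notin family_fv t `|` domf t ->
    dline (Y |-[F] SSub t (SAll y X))
          (Y |-[F] SAll z (SSub t.[y <- TVar z] X))
| d_sub_subl F t s X Y : domf t = family_fv s ->
    dline (PSub t (PSub s X) |-[F] Y) (PSub (family_subst t s) X |-[F] Y)
| d_sub_subr F t s X Y : domf t = family_fv s ->
    dline (Y |-[F] SSub t (SSub s X)) (Y |-[F] SSub (family_subst t s) X)
| d_sub_incl F s y t zs X Y :
    y \notin domf t -> lists zs (tfv s `\` family_fv t) ->
    dline (PSub t.[y <- s] (PInc y X) |-[F] Y) (PIncs zs (PSub t X) |-[F] Y)
| d_sub_incr F s y t zs X Y :
    y \notin domf t -> lists zs (tfv s `\` family_fv t) ->
    dline (Y |-[F] SSub t.[y <- s] (SInc y X)) (Y |-[F] SIncs zs (SSub t X)).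

Inductive rule1 (L : language) : sequent L -> sequent L -> Prop :=
| r_down S1 S2 : dline S1 S2 -> rule1 S1 S2
| r_up S1 S2 : dline S1 S2 -> rule1 S2 S1
| r_inc_ex F x X Y :
    rule1 (PInc x (PEx x X) |-[F] Y) (X |-[F] Y)
| r_sub_exsub F t X Y :
    rule1 (PSub t (PExSub t X) |-[F] Y) (X |-[F] Y)
| r_atom_rel F r (t s : args L (rel_arity r)) ts ss X :
    alpha_eq (tau (MSubs ts (MRel t))) (tau (MSubs ss (MRel s))) ->
    rule1 (PSubs ss (PRel s) |-[F] X) (PSubs ts (PRel t) |-[F] X)
| r_atom_eq F r1 r2 r3 r4 ts ss X :
    alpha_eq (tau (MSubs ts (MEq r1 r2))) (tau (MSubs ss (MEq r3 r4))) ->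
    rule1 (PSubs ss (PEq r3 r4) |-[F] X) (PSubs ts (PEq r1 r2) |-[F] X)
| r_exchl F X Y Z :
    rule1 (PAnd Y X |-[F] Z) (PAnd X Y |-[F] Z)
| r_exchr F X Y Z :
    rule1 (Z |-[F] SOr X Y) (Z |-[F] SOr Y X)
| r_weakl F X Y Z :
    rule1 (Y |-[F] Z) (PAnd X Y |-[F] Z)
| r_weakr F X Y Z :
    rule1 (Z |-[F] Y) (Z |-[F] SOr Y X)
| r_contrl F X Y :
    rule1 (PAnd X X |-[F] Y) (X |-[F] Y)
| r_contrr F X Y :
    rule1 (Y |-[F] SOr X X) (Y |-[F] X)
| r_eq_refl F t X Y :
    rule1 (PAnd (PEq t t) X |-[F] Y) (X |-[F] Y)
| r_eq_subst F s t y r xs ys zs X :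
    y \notin domf r ->
    lists xs (family_fv r `\` (tfv t `|` tfv s)) ->
    lists ys (tfv s `\` (tfv t `|` family_fv r)) ->
    lists zs (tfv t `\` (tfv s `|` family_fv r)) ->
    rule1 (PIncs xs (PEq t s) |-[F] SIncs ys (SSub r.[y <- t] X))
          (PIncs xs (PEq t s) |-[F] SIncs zs (SSub r.[y <- s] X))
| r_rel F r (s : args L (rel_arity r)) X :
    rule1 (PRel s |-[F] X) (PForm (MRel s) |-[F] X)
| r_eq F s t X :
    rule1 (PEq s t |-[F] X) (PForm (MEq s t) |-[F] X)
| r_bot F X :
    rule1 (X |-[F] SBot F) (X |-[F] SForm (MBot F))
| r_top F X :
    rule1 (PTop F |-[F] X) (PForm (MTop F) |-[F] X)
| r_andl F A B X :
    rule1 (PAnd (PForm A) (PForm B) |-[F] X) (PForm (MAnd A B) |-[F] X)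
| r_orr F A B X :
    rule1 (X |-[F] SOr (SForm A) (SForm B)) (X |-[F] SForm (MOr A B))
| r_impr F A B X :
    rule1 (X |-[F] SImp (PForm A) (SForm B)) (X |-[F] SForm (MImp A B))
| r_exl F x A X :
    rule1 (PEx x (PForm A) |-[F] X) (PForm (MEx x A) |-[F] X)
| r_exr F x A X :
    rule1 (X |-[x |` F] SForm A) (PEx x X |-[F `\ x] SForm (MEx x A))
| r_alll F x A X :
    rule1 (PForm A |-[x |` F] X) (PForm (MAll x A) |-[F `\ x] SAll x X)
| r_allr F x A X :
    rule1 (X |-[F] SAll x (SForm A)) (X |-[F] SForm (MAll x A))
| r_incl F x A X :
    rule1 (PInc x (PForm A) |-[F] X) (PForm (MInc x A) |-[F] X)
| r_incr F x A X :
    rule1 (X |-[F] SInc x (SForm A)) (X |-[F] SForm (MInc x A))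
| r_subl F t A X :
    rule1 (PSub t (PForm A) |-[F] X) (PForm (MSub t A) |-[F] X)
| r_subr F t A X :
    rule1 (X |-[F] SSub t (SForm A)) (X |-[F] SForm (MSub t A))
| r_grishinl F X Y Z W :
    rule1 (PSucc X (PAnd Y Z) |-[F] W) (PAnd (PSucc X Y) Z |-[F] W)
| r_grishinr F X Y Z W :
    rule1 (W |-[F] SImp X (SOr Y Z)) (W |-[F] SOr (SImp X Y) Z)
| r_sub_mono t X Y :
    rule1 (X |-[domf t] Y) (PSub t X |-[family_fv t] SSub t Y).

Inductive rule2 (L : language) : sequent L -> sequent L -> sequent L -> Prop :=
| r_andr F A B X Y :
    rule2 (X |-[F] SForm A) (Y |-[F] SForm B)
          (PAnd X Y |-[F] SForm (MAnd A B))
| r_orl F A B X Y :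
    rule2 (PForm A |-[F] X) (PForm B |-[F] Y)
          (PForm (MOr A B) |-[F] SOr X Y)
| r_impl F A B X Y :
    rule2 (X |-[F] SForm A) (PForm B |-[F] Y)
          (PForm (MImp A B) |-[F] SImp X Y).

(* Every sequent of a derivation is well-typed (for the conclusion of Cut this
   follows from the premises). *)
Inductive derivation (L : language) : sequent L -> Type :=
| Axiom0 S : axiom S -> well_typed S -> derivation S
| Rule1 S1 S : rule1 S1 S -> well_typed S -> derivation S1 -> derivation S
| Rule2 S1 S2 S : rule2 S1 S2 S -> well_typed S ->
    derivation S1 -> derivation S2 -> derivation S
| Cut F X A Y :
    derivation (X |-[F] SForm A) -> derivation (PForm A |-[F] Y) ->
    derivation (X |-[F] Y).

Fixpoint cut_free (L : language) (S : sequent L) (d : derivation S) : Prop :=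
  match d with
  | Axiom0 _ _ _ => True
  | Rule1 _ _ _ _ d1 => cut_free d1
  | Rule2 _ _ _ _ _ d1 d2 => cut_free d1 /\ cut_free d2
  | Cut _ _ _ _ _ _ => False
  end.

Fixpoint in_derivation (L : language) (A : mform L) (S : sequent L)
    (d : derivation S) : Prop :=
  in_sequent A S \/
  match d with
  | Axiom0 _ _ _ => False
  | Rule1 _ _ _ _ d1 => in_derivation A d1
  | Rule2 _ _ _ _ _ d1 d2 => in_derivation A d1 \/ in_derivation A d2
  | Cut _ _ _ _ d1 d2 => in_derivation A d1 \/ in_derivation A d2
  end.

(* Main.v *)
Require Import Defs.
From mathcomp Require Import all_boot.
From mathcomp Require Import finmap.

(** The proof is Belnap's.  Each left (right) introduction rule displays its
    principal formula as the whole antecedent (succedent), and every other rule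
    is closed under replacing occurrences of a formula in precedent (succedent)
    position by a precedent (succedent) structure of the same type.  So a cut
    [X |- A], [A |- Y] can be pushed up first along the occurrences of [A] in
    the left premise and then along those in the right one, until [A] is
    principal on both sides; there the display rules reduce it to cuts on
    immediate subformulas.  The subformula property holds because no rule other
    than Cut loses a formula from premise to conclusion. *)

Set Implicit Arguments.
Unset Strict Implicit.
Unset Printing Implicit Defensive.

Local Open Scope fset_scope.
Local Open Scope fmap_scope.

(* Induction schemes and uniqueness of types *)
Scheme ptype_mind := Induction for ptype Sort Prop
  with stype_mind := Induction for stype Sort Prop.
Combined Scheme ptype_stype_ind from ptype_mind, stype_mind.
Scheme pstr_mind := Induction for pstr Sort Prop
  with sstr_mind := Induction for sstr Sort Prop.
Combined Scheme pstr_sstr_ind from pstr_mind, sstr_mind.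

(** A candidate type read off the raw syntax, meaningful only on well-typed formulas. *)
Fixpoint type_of (L : language) (A : mform L) : {fset Var} :=
  match A with
  | MRel _ ts => args_fv ts
  | MEq s t => tfv s `|` tfv t
  | MTop F | MBot F => F
  | MAnd A _ | MOr A _ | MImp A _ => type_of A
  | MAll y A | MEx y A => type_of A `\ y
  | MInc x A => x |` type_of A
  | MSub t _ => family_fv t
  end.

Lemma mtype_type_of (L : language) (A : mform L) F : mtype A F -> F = type_of A.
Proof.
elim=> //= {A F} [F y A yF _ <-|F y A yF _ <-|F x A xF _ <-].
- by rewrite fsetU1K.
- by rewrite fsetU1K.
- by rewrite fsetD1K.
Qed.

(** Traced through a derivation, a cut formula may turn up in sequents of other types. Uniqueness
    forces each sequent displaying it to have the type of the cut. *)
Lemma mtype_unique (L : language) (A : mform L) F G :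
  mtype A F -> mtype A G -> F = G.
Proof. by move=> /mtype_type_of-> /mtype_type_of->. Qed.

(** * Cut-free derivability and principal introductions *)

Inductive cf_derivable (L : language) : sequent L -> Prop :=
| cf_axiom S : axiom S -> well_typed S -> cf_derivable S
| cf_rule1 S1 S : rule1 S1 S -> well_typed S -> cf_derivable S1 ->
    cf_derivable S
| cf_rule2 S1 S2 S : rule2 S1 S2 S -> well_typed S ->
    cf_derivable S1 -> cf_derivable S2 -> cf_derivable S.

Lemma cf_derivableP (L : language) (S : sequent L) :
  cf_derivable S -> exists d : derivation S, cut_free d.
Proof.
elim=> {S} [S ax wt|S1 S r wt _ [d cd]|S1 S2 S r wt _ [d cd] _ [d' cd']].
- by exists (Axiom0 ax wt).
- by exists (Rule1 r wt d).
- by exists (Rule2 r wt d d').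
Qed.

Lemma cf_derivable_wt (L : language) (S : sequent L) :
  cf_derivable S -> well_typed S.
Proof. by case. Qed.

Section Intro.

Variables (L : language) (F : {fset Var}).

(* The last step of a cut-free derivation of [A |-[F] Y] introducing [A]. *)
Definition left_intro (A : mform L) (Y : sstr L) : Prop :=
  match A with
  | MRel _ ts => cf_derivable (PRel ts |-[F] Y)
  | MEq s t => cf_derivable (PEq s t |-[F] Y)
  | MTop _ => cf_derivable (PTop F |-[F] Y)
  | MBot _ => Y = SBot F
  | MAnd A B => cf_derivable (PAnd (PForm A) (PForm B) |-[F] Y)
  | MOr A B => exists Y1 Y2, Y = SOr Y1 Y2 /\
      cf_derivable (PForm A |-[F] Y1) /\ cf_derivable (PForm B |-[F] Y2)
  | MImp A B => exists X1 Y2, Y = SImp X1 Y2 /\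
      cf_derivable (X1 |-[F] SForm A) /\ cf_derivable (PForm B |-[F] Y2)
  | MAll x A => exists G Y1, (F = G `\ x /\ Y = SAll x Y1) /\
      cf_derivable (PForm A |-[x |` G] Y1)
  | MEx x A => cf_derivable (PEx x (PForm A) |-[F] Y)
  | MInc x A => cf_derivable (PInc x (PForm A) |-[F] Y)
  | MSub t A => cf_derivable (PSub t (PForm A) |-[F] Y)
  end.

(* The last step of a cut-free derivation of [X |-[F] A] introducing [A]. *)
Definition right_intro (X : pstr L) (A : mform L) : Prop :=
  match A with
  | MRel _ ts => X = PRel ts
  | MEq s t => X = PEq s t
  | MTop _ => X = PTop F
  | MBot _ => cf_derivable (X |-[F] SBot F)
  | MAnd A B => exists X1 X2, X = PAnd X1 X2 /\
      cf_derivable (X1 |-[F] SForm A) /\ cf_derivable (X2 |-[F] SForm B)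
  | MOr A B => cf_derivable (X |-[F] SOr (SForm A) (SForm B))
  | MImp A B => cf_derivable (X |-[F] SImp (PForm A) (SForm B))
  | MAll x A => cf_derivable (X |-[F] SAll x (SForm A))
  | MEx x A => exists G X1, (F = G `\ x /\ X = PEx x X1) /\
      cf_derivable (X1 |-[x |` G] SForm A)
  | MInc x A => cf_derivable (X |-[F] SInc x (SForm A))
  | MSub t A => cf_derivable (X |-[F] SSub t (SForm A))
  end.

End Intro.

(** * Replacing formula leaves by structures *)

Section Replacement.

(** [RP A X] allows a precedent leaf [A] to become [X]; [RS] does the same for succedent leaves. *)
Variables (L : language) (RP : mform L -> pstr L -> Prop).
Variable RS : mform L -> sstr L -> Prop.

(* Any set of formula leaves may be replaced, not necessarily all occurrences
   of a given formula. *)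
Fixpoint prepl (X X' : pstr L) {struct X} : Prop :=
  match X with
  | PForm A => X' = X \/ RP A X'
  | PTop _ | PRel _ _ | PEq _ _ => X' = X
  | PAnd X1 X2 =>
      exists X1' X2', X' = PAnd X1' X2' /\ prepl X1 X1' /\ prepl X2 X2'
  | PSucc Y X1 => exists Y' X1', X' = PSucc Y' X1' /\ srepl Y Y' /\ prepl X1 X1'
  | PPrec X1 Y => exists X1' Y', X' = PPrec X1' Y' /\ prepl X1 X1' /\ srepl Y Y'
  | PEx x X1 => exists X1', X' = PEx x X1' /\ prepl X1 X1'
  | PInc x X1 => exists X1', X' = PInc x X1' /\ prepl X1 X1'
  | PSub t X1 => exists X1', X' = PSub t X1' /\ prepl X1 X1'
  | PExSub t X1 => exists X1', X' = PExSub t X1' /\ prepl X1 X1'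
  end
with srepl (Y Y' : sstr L) {struct Y} : Prop :=
  match Y with
  | SForm A => Y' = Y \/ RS A Y'
  | SBot _ => Y' = Y
  | SOr Y1 Y2 =>
      exists Y1' Y2', Y' = SOr Y1' Y2' /\ srepl Y1 Y1' /\ srepl Y2 Y2'
  | SImp X Y1 => exists X' Y1', Y' = SImp X' Y1' /\ prepl X X' /\ srepl Y1 Y1'
  | SLmi Y1 X => exists Y1' X', Y' = SLmi Y1' X' /\ srepl Y1 Y1' /\ prepl X X'
  | SAll x Y1 => exists Y1', Y' = SAll x Y1' /\ srepl Y1 Y1'
  | SInc x Y1 => exists Y1', Y' = SInc x Y1' /\ srepl Y1 Y1'
  | SSub t Y1 => exists Y1', Y' = SSub t Y1' /\ srepl Y1 Y1'
  | SAllSub t Y1 => exists Y1', Y' = SAllSub t Y1' /\ srepl Y1 Y1'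
  end.

Definition seqrepl (S S' : sequent L) : Prop :=
  [/\ prepl (seq_pre S) (seq_pre S'), seq_type S' = seq_type S
    & srepl (seq_suc S) (seq_suc S')].

Lemma repl_refl : (forall X, prepl X X) /\ (forall Y, srepl Y Y).
Proof. by apply: pstr_sstr_ind => /=; eauto 6. Qed.

Lemma prepl_refl X : prepl X X. Proof. exact: repl_refl.1. Qed.
Lemma srepl_refl Y : srepl Y Y. Proof. exact: repl_refl.2. Qed.

(** Some rules apply a block of tilde operators of arbitrary length, so a replacement has to be
    inverted and rebuilt through the whole block. *)
Lemma prepl_PIncs zs X X' :
  prepl (PIncs zs X) X' <-> exists X1, X' = PIncs zs X1 /\ prepl X X1.
Proof.
elim: zs X' => [|z zs IH] X' /=; first by split=> [|[X1 [->]] //]; exists X'.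
split=> [[X1 [-> /IH [X2 [-> ?]]]]|[X1 [-> ?]]]; first by exists X2.
by eexists; split; first by []; apply/IH; exists X1.
Qed.

Lemma srepl_SIncs zs Y Y' :
  srepl (SIncs zs Y) Y' <-> exists Y1, Y' = SIncs zs Y1 /\ srepl Y Y1.
Proof.
elim: zs Y' => [|z zs IH] Y' /=; first by split=> [|[Y1 [->]] //]; exists Y'.
split=> [[Y1 [-> /IH [Y2 [-> ?]]]]|[Y1 [-> ?]]]; first by exists Y2.
by eexists; split; first by []; apply/IH; exists Y1.
Qed.

Lemma prepl_PSubs ts X X' :
  prepl (PSubs ts X) X' <-> exists X1, X' = PSubs ts X1 /\ prepl X X1.
Proof.
elim: ts X' => [|t ts IH] X' /=; first by split=> [|[X1 [->]] //]; exists X'.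
split=> [[X1 [-> /IH [X2 [-> ?]]]]|[X1 [-> ?]]]; first by exists X2.
by eexists; split; first by []; apply/IH; exists X1.
Qed.

Lemma prepl_ptilde o X X' :
  prepl (ptilde o X) X' <-> exists X1, X' = ptilde o X1 /\ prepl X X1.
Proof. by case: o. Qed.

Lemma srepl_stilde o Y Y' :
  srepl (stilde o Y) Y' <-> exists Y1, Y' = stilde o Y1 /\ srepl Y Y1.
Proof. by case: o. Qed.

Ltac split_repl := repeat match goal with
  | H : exists _, _ |- _ => case: H => ? H
  | H : _ /\ _ |- _ => case: H => ? H
  | H : prepl (PIncs _ _) _ |- _ => move/prepl_PIncs: H => H
  | H : prepl (PSubs _ _) _ |- _ => move/prepl_PSubs: H => H
  | H : prepl (ptilde _ _) _ |- _ => move/prepl_ptilde: H => H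
  | H : srepl (SIncs _ _) _ |- _ => move/srepl_SIncs: H => H
  | H : srepl (stilde _ _) _ |- _ => move/srepl_stilde: H => H
  | H : prepl _ _ |- _ => progress simpl in H
  | H : srepl _ _ |- _ => progress simpl in H
  | H : ?x = _ |- _ => is_var x; subst x
  end.

Ltac repl := first
  [ eassumption | exact: prepl_refl | exact: srepl_refl
  | apply/prepl_PIncs; eexists; split; [reflexivity|repl]
  | apply/prepl_PSubs; eexists; split; [reflexivity|repl]
  | apply/prepl_ptilde; eexists; split; [reflexivity|repl]
  | apply/srepl_SIncs; eexists; split; [reflexivity|repl]
  | apply/srepl_stilde; eexists; split; [reflexivity|repl]
  | do 2 eexists; split; [reflexivity|split; repl]
  | eexists; split; [reflexivity|repl] ].

Ltac seqrepl := split; [repl|reflexivity|repl].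

(** These rules mention no formula, and each structure variable occurs exactly once on either side,
    so a replacement on one side determines one on the other. *)
Lemma dline_repl_down S1 S2 S2' : dline S1 S2 -> seqrepl S2 S2' ->
  exists S1', dline S1' S2' /\ seqrepl S1 S1'.
Proof.
case: S2' => U G V; case=> * /=.
all: match goal with H : seqrepl _ _ |- _ => case: H end => /= rU rG rV.
all: split_repl.
all: eexists; split; [econstructor; eassumption|seqrepl].
Qed.

Lemma dline_repl_up S1 S2 S1' : dline S1 S2 -> seqrepl S1 S1' ->
  exists S2', dline S1' S2' /\ seqrepl S2 S2'.
Proof.
case: S1' => U G V; case=> * /=.
all: match goal with H : seqrepl _ _ |- _ => case: H end => /= rU rG rV.
all: split_repl.
all: eexists; split; [econstructor; eassumption|seqrepl].
Qed.

Hypothesis RP_type : forall A X F, RP A X -> mtype A F -> ptype X F.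
Hypothesis RS_type : forall A Y F, RS A Y -> mtype A F -> stype Y F.

Lemma repl_type :
  (forall X F, ptype X F -> forall X', prepl X X' -> ptype X' F) /\
  (forall Y F, stype Y F -> forall Y', srepl Y Y' -> stype Y' F).
Proof.
apply: ptype_stype_ind => /=.
all: try by move=> *; split_repl; constructor; eauto.
- by move=> F A AF X' [->|/RP_type]; [constructor|apply].
- by move=> F A AF X' [->|/RS_type]; [constructor|apply].
Qed.

Lemma seqrepl_wt S S' : seqrepl S S' -> well_typed S -> well_typed S'.
Proof.
case: S S' => [X F Y] [X' F' Y'] [/= rX -> rY] [tX tY].
by split=> /=; [apply: repl_type.1 rX|apply: repl_type.2 rY].
Qed.

(** Replacement commutes with every rule except at a leaf that the last step introduces; these two
    hypotheses cover exactly that case. *)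
Hypothesis left_intro_repl : forall A X F Y, RP A X ->
  well_typed (PForm A |-[F] Y) -> left_intro F A Y -> cf_derivable (X |-[F] Y).
Hypothesis right_intro_repl : forall A X F Y, RS A Y ->
  well_typed (X |-[F] SForm A) -> right_intro F X A -> cf_derivable (X |-[F] Y).

Ltac use_rule := match goal with
  | IH : forall S, seqrepl _ S -> cf_derivable S |- cf_derivable _ =>
      first [ eapply cf_rule1; [econstructor; eassumption|eassumption|apply: IH; seqrepl]
            | apply: IH; seqrepl ]
  end.

(** The introduced leaf is kept while the context around it is replaced; only then does the
    hypothesis exchange the leaf itself. *)
Ltac principal := match goal with
  | R : RP ?A _, wt : well_typed _ |- _ =>
      apply: (left_intro_repl R); [apply: seqrepl_wt wt; seqrepl|]
  | R : RS ?A _, wt : well_typed _ |- _ =>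
      apply: (right_intro_repl R); [apply: seqrepl_wt wt; seqrepl|]
  end.

(** Induction on the derivation. Replacing only chosen leaves is essential: when a rule introduces a
    compound formula, its components in the premise must stay, even if one of them equals the
    formula being replaced elsewhere. *)
Lemma cf_derivable_repl S S' :
  cf_derivable S -> seqrepl S S' -> cf_derivable S'.
Proof.
move=> d; elim: d S' => {S} [S ax wt|S1 S r wt d IH|S1 S2 S r wt d1 IH1 d2 IH2] S' rS.
all: have wt' := seqrepl_wt rS wt.
{ case: S' rS wt' => U G V; case: ax wt => *.
  all: match goal with H : seqrepl _ _ |- _ => case: H end => /= rU rG rV.
  all: split_repl.
  all: repeat match goal with H : _ \/ _ |- _ => case: H => H end; split_repl.
  all: try by apply: cf_axiom => //; constructor.
  all: principal => //. }
{ case: S' rS wt' => U G V; case: r wt d IH => *.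
  (* Display rules: carry the replacement over to the premise and reapply the rule in the same
     direction. *)
  all: try (match goal with H : dline _ _, H' : seqrepl _ _, IH : _ |- _ =>
    first [case: (dline_repl_down H H') | case: (dline_repl_up H H')] =>
      S0 [dl0 /IH d0] end;
    first [exact: cf_rule1 (r_down dl0) _ d0|exact: cf_rule1 (r_up dl0) _ d0]).
  all: match goal with H : seqrepl _ _ |- _ => case: H end => /= rU rG rV.
  all: split_repl.
  all: repeat match goal with H : _ \/ _ |- _ => case: H => H end; split_repl.
  (* No introduced leaf is replaced here: the same rule applies to the replaced premise. *)
  all: try use_rule.
  all: try (principal => /=; repeat (eexists || split); use_rule). }
case: S' rS wt' => U G V; case: r wt d1 IH1 d2 IH2 => *.
all: match goal with H : seqrepl _ _ |- _ => case: H end => /= rU rG rV.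
all: split_repl.
all: repeat match goal with H : _ \/ _ |- _ => case: H => H end; split_repl.
all: try (eapply cf_rule2; [econstructor|eassumption|use_rule|use_rule]).
all: principal; do 2 eexists; split; [reflexivity|split; use_rule].
Qed.

End Replacement.

(** * Cut elimination *)

Section CutElimination.

Variable L : language.

Definition cut_admissible (A : mform L) : Prop := forall F X Y,
  cf_derivable (X |-[F] SForm A) -> cf_derivable (PForm A |-[F] Y) ->
  cf_derivable (X |-[F] Y).

Definition principal_cut_admissible (A : mform L) : Prop := forall F X Y,
  well_typed (X |-[F] SForm A) -> well_typed (PForm A |-[F] Y) ->
  right_intro F X A -> left_intro F A Y -> cf_derivable (X |-[F] Y).

Lemma mtype_PForm F (A : mform L) : ptype (PForm A) F -> mtype A F.
Proof. by move=> H; inversion H. Qed.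

Lemma mtype_SForm F (A : mform L) : stype (SForm A) F -> mtype A F.
Proof. by move=> H; inversion H. Qed.

Lemma cut_of_principal A : principal_cut_admissible A -> cut_admissible A.
Proof.
move=> prc F X Y dX dY.
have [tX /mtype_SForm /= tA] := cf_derivable_wt dX.
have [_ /= tY] := cf_derivable_wt dY.
(* First pass: in [dX], only succedent leaves [A] may change, into [Y]. *)
apply: (@cf_derivable_repl L (fun _ _ => False)
  (fun B Y' => B = A /\ Y' = Y) _ _ _ _ _ _ dX) => //=.
- by move=> B Y' G [-> ->] /(mtype_unique tA) <-.
- move=> B X' G Y' [-> ->] wt riA.
  have tA' : mtype A G := mtype_SForm wt.2.
  rewrite -(mtype_unique tA tA') in wt riA *.
  (* Second pass, where [A] is introduced on the right over [X']: in [dY], precedent leaves [A] may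
     become [X']. A left introduction met there leaves a principal cut. *)
  apply: (@cf_derivable_repl L (fun B X'' => B = A /\ X'' = X')
    (fun _ _ => False) _ _ _ _ _ _ dY) => //=.
  + by move=> C X'' H [-> ->] /(mtype_unique tA) <-; case: wt.
  + move=> C X'' H Z [-> ->] wtZ liA.
    have tA'' : mtype A H := mtype_PForm wtZ.1.
    rewrite -(mtype_unique tA tA'') in wtZ liA *.
    exact: prc.
  + by split=> //=; [right|apply: srepl_refl].
- by split=> //=; [apply: prepl_refl|right].
Qed.

Lemma cf_down (S1 S2 : sequent L) :
  dline S1 S2 -> cf_derivable S1 -> well_typed S2 -> cf_derivable S2.
Proof. by move=> d d1 wt; apply: cf_rule1 (r_down d) wt d1. Qed.

Lemma cf_up (S1 S2 : sequent L) :
  dline S1 S2 -> cf_derivable S2 -> well_typed S1 -> cf_derivable S1.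
Proof. by move=> d d2 wt; apply: cf_rule1 (r_up d) wt d2. Qed.

Ltac typing := repeat match goal with
  | H : well_typed _ |- _ => case: H => /= ? ?
  end; by split=> /=; repeat constructor.

(** Residuation displays [B] for the first cut; after moving back, it displays [A] for the
    second. *)
Lemma principal_cut_and A B : cut_admissible A -> cut_admissible B ->
  principal_cut_admissible (MAnd A B).
Proof.
move=> cA cB F _ Z _ [/= _ tZ] [X [Y [-> [dA dB]]]] dZ.
have wA := cf_derivable_wt dA; have wB := cf_derivable_wt dB.
have [/= tX /mtype_SForm tA] := wA; have [/= tY /mtype_SForm tB] := wB.
apply: (cf_up (d_and_lmi _ _ _ _)); last by typing.
apply: cA dA _; apply: (cf_down (d_and_lmi _ _ _ _)); last by typing.
apply: (cf_up (d_and_imp _ _ _ _)); last by typing.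
apply: cB dB _; apply: (cf_down (d_and_imp _ _ _ _)) dZ _.
by typing.
Qed.

Lemma principal_cut_or A B : cut_admissible A -> cut_admissible B ->
  principal_cut_admissible (MOr A B).
Proof.
move=> cA cB F X _ [/= tX _] _ dX [Y [Z [-> [dA dB]]]].
have wA := cf_derivable_wt dA; have wB := cf_derivable_wt dB.
have [/= /mtype_PForm tA tY] := wA; have [/= /mtype_PForm tB tZ] := wB.
apply: (cf_up (d_or_prec _ _ _ _)); last by typing.
apply: cA _ dA; apply: (cf_down (d_or_prec _ _ _ _)); last by typing.
apply: (cf_up (d_or_succ _ _ _ _)); last by typing.
apply: cB _ dB; apply: (cf_down (d_or_succ _ _ _ _)) dX _.
by typing.
Qed.

(** Residuating [dX] puts [A] next to [X] on the left and isolates [B] on the right. The cut on [B]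
    comes first, then [A] is displayed and cut. *)
Lemma principal_cut_imp A B : cut_admissible A -> cut_admissible B ->
  principal_cut_admissible (MImp A B).
Proof.
move=> cA cB F X _ [/= tX _] _ dX [Y [Z [-> [dA dB]]]].
have [/= tY /mtype_SForm tA] := cf_derivable_wt dA.
have [/= /mtype_PForm tB tZ] := cf_derivable_wt dB.
apply: (cf_down (d_and_imp _ _ _ _)); last by typing.
apply: (cf_up (d_and_lmi _ _ _ _)); last by typing.
apply: cA dA _; apply: (cf_down (d_and_lmi _ _ _ _)); last by typing.
apply: cB _ dB; apply: (cf_up (d_and_imp _ _ _ _)) dX _.
by typing.
Qed.

Lemma principal_cut_all x A : cut_admissible A ->
  principal_cut_admissible (MAll x A).
Proof.
move=> cA F X _ [/= tX _] _ dX [G [Y [[eF ->] dA]]]; subst F.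
have [/= /mtype_PForm tA tY] := cf_derivable_wt dA.
apply: (cf_down (d_inc_all _ _ _ _)); last by typing.
apply: cA _ dA; apply: (cf_up (d_inc_all _ _ _ _)) dX _.
by typing.
Qed.

Lemma principal_cut_ex x A : cut_admissible A ->
  principal_cut_admissible (MEx x A).
Proof.
move=> cA F _ Z _ [/= _ tZ] [G [X [[eF ->] dA]]] dZ; subst F.
have [/= tX /mtype_SForm tA] := cf_derivable_wt dA.
apply: (cf_down (d_ex_inc _ _ _ _)); last by typing.
apply: cA dA _; apply: (cf_up (d_ex_inc _ _ _ _)) dZ _.
by typing.
Qed.

(** Both premises are moved by adjunction to the smaller type, where [A] lives, and cut there. Going
    back leaves [PInc x (PEx x X)] on the left, which [r_inc_ex] contracts to [X]. *)
Lemma principal_cut_inc x A : cut_admissible A ->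
  principal_cut_admissible (MInc x A).
Proof.
move=> cA F X Y [/= tX /mtype_SForm tA] [/= _ tY] dX dY.
have [xF {}tA] : x \in F /\ mtype A (F `\ x) by inversion tA.
(* The adjunction rules are stated at [F] with [x] added, which is [F] itself as [x] belongs to
   it. *)
have eF : x |` F = F by apply/fsetUidPr; rewrite fsub1set.
have tX' : ptype X (x |` F) by rewrite eF.
have tY' : stype Y (x |` F) by rewrite eF.
apply: cf_rule1 (r_inc_ex F x X Y) _ _; first by typing.
rewrite -eF; apply: (cf_up (d_inc_all _ _ _ _)); last by typing.
apply: (cA _ _ _).
- by apply: (cf_down (d_ex_inc _ _ _ _)); [rewrite eF|typing].
- by apply: (cf_down (d_inc_all _ _ _ _)); [rewrite eF|typing].
Qed.

(** As for [MInc], with the adjoints of the substitution operator and [r_sub_exsub]. *)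
Lemma principal_cut_sub t A : cut_admissible A ->
  principal_cut_admissible (MSub t A).
Proof.
move=> cA F X Y [/= tX /mtype_SForm tA] [/= _ tY] dX dY.
have [eF {}tA] : F = family_fv t /\ mtype A (domf t) by inversion tA.
subst F.
apply: cf_rule1 (r_sub_exsub _ t X Y) _ _; first by typing.
apply: (cf_up (d_sub_all _ _ _)); last by typing.
apply: (cA _ _ _).
- by apply: (cf_down (d_ex_sub _ _ _)) dX _; typing.
- by apply: (cf_down (d_sub_all _ _ _)) dY _; typing.
Qed.

Lemma cut_elimination A : cut_admissible A.
Proof.
apply: cut_of_principal.
elim: A => [r ts|s t|G|G|A /cut_of_principal cA B /cut_of_principal cB
  |A /cut_of_principal cA B /cut_of_principal cB
  |A /cut_of_principal cA B /cut_of_principal cB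
  |x A /cut_of_principal cA|x A /cut_of_principal cA
  |x A /cut_of_principal cA|t A /cut_of_principal cA].
(* For atoms and constants one introduction fixes the opposite structure, so the other premise
   already is the conclusion. *)
- by move=> F X Y _ _ /= ->.
- by move=> F X Y _ _ /= ->.
- by move=> F X Y _ _ /= ->.
- by move=> F X Y _ _ /= dX ->.
- exact: principal_cut_and.
- exact: principal_cut_or.
- exact: principal_cut_imp.
- exact: principal_cut_all.
- exact: principal_cut_ex.
- exact: principal_cut_inc.
- exact: principal_cut_sub.
Qed.

Lemma derivation_cf_derivable (S : sequent L) : derivation S -> cf_derivable S.
Proof.
elim=> {S} [S ax wt|S1 S r wt _ d|S1 S2 S r wt _ d1 _ d2|F X A Y _ d1 _ d2].
- exact: cf_axiom.
- exact: cf_rule1 r wt d.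
- exact: cf_rule2 r wt d1 d2.
- exact: cut_elimination d1 d2.
Qed.

End CutElimination.

(** * Subformula property *)

Section SubformulaProperty.

Variables (L : language) (A : mform L).

Lemma in_PIncs zs (X : pstr L) : in_pstr A (PIncs zs X) = in_pstr A X.
Proof. by elim: zs. Qed.

Lemma in_SIncs zs (Y : sstr L) : in_sstr A (SIncs zs Y) = in_sstr A Y.
Proof. by elim: zs. Qed.

Lemma in_PSubs ts (X : pstr L) : in_pstr A (PSubs ts X) = in_pstr A X.
Proof. by elim: ts. Qed.

Lemma in_ptilde o (X : pstr L) : in_pstr A (ptilde o X) = in_pstr A X.
Proof. by case: o. Qed.

Lemma in_stilde o (Y : sstr L) : in_sstr A (stilde o Y) = in_sstr A Y.
Proof. by case: o. Qed.

Definition inE_str := (in_PIncs, in_SIncs, in_PSubs, in_ptilde, in_stilde).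

Lemma dline_in (S1 S2 : sequent L) : dline S1 S2 ->
  in_sequent A S1 <-> in_sequent A S2.
Proof. by case=> *; rewrite /in_sequent /= ?inE_str /= ?inE_str; tauto. Qed.

End SubformulaProperty.

Definition sub_sequent (L : language) (A : mform L) (S : sequent L) : Prop :=
  exists B, in_sequent B S /\ subformula A B.

Lemma subformula_trans (L : language) (A B C : mform L) :
  subformula A B -> subformula B C -> subformula A C.
Proof. by move=> AB; elim=> * //; constructor. Qed.

(** Either the formula persists in the conclusion, or it is an immediate component of the formula
    introduced on the left or on the right. *)
Ltac find_sub := subst; solve
  [ eexists; split; [|apply: Defs.sub_refl]; rewrite /in_sequent /= ?inE_str /=; tauto
  | eexists; split; [left; simpl; reflexivity|constructor; apply: Defs.sub_refl]
  | eexists; split; [right; simpl; reflexivity|constructor; apply: Defs.sub_refl] ].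

(** The atoms that [r_atom_rel], [r_atom_eq] and [r_eq_refl] change or discard are structural, not
    formulas, so nothing is lost there. *)
Lemma rule1_in (L : language) (A : mform L) (S1 S : sequent L) :
  rule1 S1 S -> in_sequent A S1 -> sub_sequent A S.
Proof.
case=> *.
all: try (match goal with dl : dline _ _, H : in_sequent _ _ |- _ =>
  by exists A; split; [apply/(dline_in A dl)|apply: Defs.sub_refl] end).
all: match goal with H : in_sequent _ _ |- _ => move: H end.
all: rewrite /in_sequent /= ?inE_str /= => H.
all: repeat match goal with H : _ \/ _ |- _ => case: H => H end.
all: try by [].
all: find_sub.
Qed.

Lemma rule2_in (L : language) (A : mform L) (S1 S2 S : sequent L) :
  rule2 S1 S2 S -> in_sequent A S1 \/ in_sequent A S2 -> sub_sequent A S.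
Proof.
case=> F B C X Y; rewrite /in_sequent /= => H.
all: repeat match goal with H : _ \/ _ |- _ => case: H => H end.
all: find_sub.
Qed.

Lemma sub_sequent_subformula (L : language) (A B : mform L) (S : sequent L) :
  subformula A B -> sub_sequent B S -> sub_sequent A S.
Proof. by move=> AB [C [CS BC]]; exists C; split=> //; apply: subformula_trans BC. Qed.

Lemma subformula_property (L : language) (S : sequent L) (d : derivation S) :
  cut_free d -> forall A, in_derivation A d -> sub_sequent A S.
Proof.
elim: d => {S} /= [S ax wt|S1 S r wt d IH|S1 S2 S r wt d1 IH1 d2 IH2|//].
- by move=> _ A [iA|//]; exists A; split=> //; apply: Defs.sub_refl.
- move=> /IH{}IH A [iA|/IH[B [iB AB]]].
    by exists A; split=> //; apply: Defs.sub_refl.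
  exact: sub_sequent_subformula AB (rule1_in r iB).
- move=> [/IH1{}IH1 /IH2{}IH2] A [iA|[/IH1|/IH2] [B [iB AB]]].
  + by exists A; split=> //; apply: Defs.sub_refl.
  + by apply: sub_sequent_subformula AB (rule2_in r _); left.
  + by apply: sub_sequent_subformula AB (rule2_in r _); right.
Qed.

Theorem mainTheorem4 (L : language) (F : {fset Var}) (X : pstr L) (Y : sstr L) :
  (forall d : derivation (X |-[F] Y),
     exists d' : derivation (X |-[F] Y), cut_free d') /\
  (forall d : derivation (X |-[F] Y), cut_free d ->
     forall A : mform L, in_derivation A d ->
       exists B : mform L, (in_pstr B X \/ in_sstr B Y) /\ subformula A B).
Proof.
split=> [d|d cfd A iA]; last exact: subformula_property cfd A iA.
exact/cf_derivableP/derivation_cf_derivable.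
Qed.
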